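(* Let $A=A_0+A_1\zeta$ with $A_0,A_1\in M_n(K)$, and suppose that $A_0$ is similar over $K$ to the Jordan block $J_{n,\alpha}$ for some $\alpha\in K$. Then the class of all matrices in $M_n(\mathcal D)$ that are similar to $A$ contains a unique matrix of the form $$J_{n,\alpha}+B_1\zeta,\qquad B_1=\begin{pmatrix}\beta_1&0&\cdots&0\\ \beta_2&0&\cdots&0\\ \vdots&\vdots&&\vdots\\ \beta_n&0&\cdots&0\end{pmatrix},\qquad \beta_1,\ldots,\beta_n\in K.$$
   Context: $K$ is an algebraically closed field of characteristic zero and $\mathcal D=K[\zeta]$ with $\zeta^2=0$ is the algebra of dual numbers over $K$. Matrices $X,Y\in M_n(\mathcal D)$ are similar if $Y=CXC^{-1}$ for some invertible $C\in M_n(\mathcal D)$. $J_{n,\alpha}\in M_n(K)$ is the upper triangular Jordan block of order $n$ with eigenvalue $\alpha$ ($\alpha$ on the diagonal, $1$ on the superdiagonal, $0$ elsewhere). *)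

(* Defs.v *)
From HB Require Import structures.
From mathcomp Require Import all_boot all_algebra.

Set Implicit Arguments.
Unset Strict Implicit.
Unset Printing Implicit Defensive.

Import GRing.Theory.
Local Open Scope ring_scope.

(* K[zeta] with zeta^2 = 0, as the quotient K[X]/(X^2).  Since 'X^2 is monic of
   size > 1, [mk_monic 'X^2] is 'X^2 itself (lemma mk_monic_Xn). *)
Notation dual K := {poly %/ ('X^2 : {poly (K : fieldType)})}.

Definition zeta (K : fieldType) : dual K := qpolyX ('X^2 : {poly K}).

(* X0 + X1 zeta, for matrices X0 and X1 over K. *)
Definition dual_mx (K : fieldType) (n : nat) (X0 X1 : 'M[K]_n) : 'M[dual K]_n :=
  map_mx (qpolyC 'X^2) X0 + zeta K *: map_mx (qpolyC 'X^2) X1.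

(* Stated over any commutative ring, as [dual K] is not a field: the relations
   based on [conjmx] in mxpoly.v are restricted to fields. *)
Definition similar_mx (R : comUnitRingType) (n : nat) (X Y : 'M[R]_n) : Prop :=
  exists C : 'M[R]_n, C \in unitmx /\ Y = C *m X *m invmx C.

Definition jordan_block (K : fieldType) (n : nat) (alpha : K) : 'M[K]_n :=
  \matrix_(i < n, j < n)
    if j == i :> nat then alpha else if j == i.+1 :> nat then 1 else 0.

Definition first_col_mx (K : fieldType) (n : nat) (beta : 'I_n -> K) : 'M[K]_n :=
  \matrix_(i < n, j < n) if j == 0 :> nat then beta i else 0.

(* Main.v *)
Require Import Defs.
From HB Require Import structures.
From mathcomp Require Import all_boot all_algebra.

(** After conjugating [A0] to [J], conjugation by [1 + P zeta] changes the
    [zeta]-part by the commutator [P J - J P], and these commutators fill in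
    everything but the first column: this gives existence.  Conversely, let
    [C0 + C1 zeta] conjugate [J + B zeta] to [J + B' zeta].  Then [C0] commutes
    with [J] and [B' C0 - C0 B = C1 J - J C1], so [tr (B' S) = tr (B S)] for
    every polynomial [S] in [J].  For [B] supported on the first column and [S] the
    [k]-th power of the nilpotent part of [J], [tr (B S)] is the [k]-th entry of
    that column: this gives uniqueness. *)

Set Implicit Arguments.
Unset Strict Implicit.
Unset Printing Implicit Defensive.

Import GRing.Theory.
Local Open Scope ring_scope.

(** * Similarity of matrices over a commutative ring *)

Section Similarity.

Context {R : comUnitRingType} {n : nat}.
Implicit Types X Y Z C : 'M[R]_n.

(** Inverse-free form: over the dual numbers, [C *m X = Y *m C] splits into a constant part and a
    [zeta]-part. *)
Lemma similar_mxP X Y :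
  similar_mx X Y <-> exists2 C, C \in unitmx & C *m X = Y *m C.
Proof.
split=> [[C [uC ->]]|[C uC eqC]]; exists C => //; first by rewrite mulmxKV.
by rewrite eqC mulmxK.
Qed.

Lemma similar_mx_sym X Y : similar_mx X Y -> similar_mx Y X.
Proof.
case=> C [uC ->]; apply/similar_mxP.
exists (invmx C); first by rewrite unitmx_inv.
by rewrite !mulmxA mulVmx // mul1mx.
Qed.

Lemma similar_mx_trans X Y Z :
  similar_mx X Y -> similar_mx Y Z -> similar_mx X Z.
Proof.
move=> /similar_mxP[C uC eqC] /similar_mxP[D uD eqD].
apply/similar_mxP; exists (D *m C); first by rewrite unitmx_mul uD.
by rewrite -mulmxA eqC mulmxA eqD mulmxA.
Qed.

End Similarity.

(** * Matrices over the dual numbers *)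

Section DualNumbers.

Context {K : fieldType}.

Lemma mk_monic_X2 : mk_monic ('X^2 : {poly K}) = 'X^2.
Proof. exact: mk_monic_Xn. Qed.

Lemma zetaE : zeta K = 'X :> {poly K}.
Proof. by rewrite /zeta qpolyXE ?size_polyXn ?monicXn. Qed.

Lemma zeta_sqr : zeta K * zeta K = 0.
Proof.
apply: val_inj; rewrite [LHS]poly_of_qpolyM zetaE [in LHS]mk_monic_X2 -expr2.
exact/Pdiv.RingMonic.rmodpp/monicXn.
Qed.

Lemma zeta_mulCE (b : K) :
  zeta K * qpolyC 'X^2 b = b *: 'X :> {poly K}.
Proof.
rewrite mulrC poly_of_qpolyM zetaE mul_polyC mk_monic_X2.
rewrite Pdiv.CommonRing.rmodp_small //.
by rewrite (leq_ltn_trans (size_scale_leq _ _)) // size_polyX size_polyXn.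
Qed.

Context {n : nat}.
Implicit Types X Y : 'M[K]_n.

Lemma coef_dual_mx X0 X1 i j :
  dual_mx X0 X1 i j = (X0 i j)%:P + X1 i j *: 'X :> {poly K}.
Proof. by rewrite !mxE -zeta_mulCE. Qed.

Lemma dual_mx_inj X0 X1 Y0 Y1 :
  dual_mx X0 X1 = dual_mx Y0 Y1 -> X0 = Y0 /\ X1 = Y1.
Proof.
move=> eqXY; have eqc i j k : ((X0 i j)%:P + X1 i j *: 'X)`_k
    = ((Y0 i j)%:P + Y1 i j *: 'X)`_k by rewrite -!coef_dual_mx eqXY.
split; apply/matrixP=> i j.
  by have := eqc i j 0%N; rewrite !coefE !mulr0 !addr0.
by have := eqc i j 1%N; rewrite !coefE !mulr1 !add0r.
Qed.

Lemma dual_mx_surj (M : 'M[dual K]_n) : exists X0 X1, M = dual_mx X0 X1.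
Proof.
exists (\matrix_(i, j) (M i j : {poly K})`_0).
exists (\matrix_(i, j) (M i j : {poly K})`_1).
apply/matrixP=> i j; apply: val_inj; rewrite /= coef_dual_mx !mxE.
apply/polyP=> -[|[|k]]; rewrite !coefE ?mulr0 ?mulr1 ?addr0 ?add0r //.
(* The representative has size at most 2, so its coefficients vanish from index 2 on. *)
rewrite nth_default // -ltnS (leq_trans (size_mk_monic _)) //.
by rewrite mk_monic_X2 size_polyXn.
Qed.

Lemma mul_dual_mx X0 X1 Y0 Y1 :
  dual_mx X0 X1 *m dual_mx Y0 Y1 = dual_mx (X0 *m Y0) (X0 *m Y1 + X1 *m Y0).
Proof.
rewrite /dual_mx map_mxD !map_mxM mulmxDl !mulmxDr -!scalemxAl -!scalemxAr.
by rewrite scalerA zeta_sqr scale0r addr0 -addrA scalerDr.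
Qed.

Lemma dual_mx1 : dual_mx 1%:M 0 = 1%:M :> 'M[dual K]_n.
Proof. by rewrite /dual_mx map_mx1 map_mx0 scaler0 addr0. Qed.

(** Taking constant parts is multiplicative, so the constant part of the inverse inverts [X0]. *)
Lemma unitmx_dual X0 X1 : dual_mx X0 X1 \in unitmx -> X0 \in unitmx.
Proof.
move=> uX; have [Y0 [Y1 eqY]] := dual_mx_surj (invmx (dual_mx X0 X1)).
have := mulmxV uX; rewrite eqY mul_dual_mx -dual_mx1.
by case/dual_mx_inj => /mulmx1_unit[].
Qed.

Lemma similar_dual_mx_const X0 X1 Y0 :
  similar_mx X0 Y0 -> exists Y1, similar_mx (dual_mx X0 X1) (dual_mx Y0 Y1).
Proof.
case=> C [uC ->]; exists (C *m X1 *m invmx C).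
apply/similar_mxP; exists (dual_mx C 0).
  suff /mulmx1_unit[] : dual_mx C 0 *m dual_mx (invmx C) 0 = 1%:M by [].
  by rewrite mul_dual_mx mulmxV // mulmx0 mul0mx addr0 dual_mx1.
by rewrite !mul_dual_mx !mulmxKV // mulmx0 mul0mx add0r addr0.
Qed.

Lemma similar_dual_mx_commutator X0 X1 P :
  similar_mx (dual_mx X0 X1) (dual_mx X0 (X1 + (P *m X0 - X0 *m P))).
Proof.
apply/similar_mxP; exists (dual_mx 1%:M P).
  suff /mulmx1_unit[] : dual_mx 1%:M P *m dual_mx 1%:M (- P) = 1%:M by [].
  by rewrite mul_dual_mx !mul1mx mulmx1 addNr dual_mx1.
rewrite !mul_dual_mx !mul1mx !mulmx1; congr dual_mx.
by rewrite addrCA [X0 *m P + _]addrC subrK.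
Qed.

(* The hypothesis on [S] says that it lies in the bicommutant of [X0]. *)
Lemma mxtrace_similar_dual X0 X1 Y1 S :
    (forall C, C *m X0 = X0 *m C -> C *m S = S *m C) ->
  similar_mx (dual_mx X0 X1) (dual_mx X0 Y1) -> \tr (Y1 *m S) = \tr (X1 *m S).
Proof.
move=> cS /similar_mxP[C]; have [C0 [C1 ->]] := dual_mx_surj C.
move=> /unitmx_dual uC0; rewrite !mul_dual_mx => /dual_mx_inj[cC0 eqC].
have cV : invmx C0 *m X0 = X0 *m invmx C0.
  by rewrite -[X0 in LHS](mulmxK uC0) -cC0 -mulmxA mulKmx.
(* [eqC] will be multiplied on the right by [D] before taking traces: [C0] cancels from the [X1] and
   [Y1] terms, and the two [C1] terms have equal traces because [D] commutes with [X0]. *)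
set D := invmx C0 *m S; have cD : D *m X0 = X0 *m D.
  by rewrite /D -mulmxA -(cS X0) // mulmxA cV mulmxA.
have eqY : Y1 *m C0 *m D = Y1 *m S by rewrite /D -mulmxA mulKVmx.
have trX : \tr (C0 *m X1 *m D) = \tr (X1 *m S).
  by rewrite -mulmxA mxtrace_mulC -mulmxA /D -mulmxA -(cS _ cC0) mulKmx.
have trC : \tr (C1 *m X0 *m D) = \tr (X0 *m C1 *m D).
  by rewrite -mulmxA -cD mulmxA mxtrace_mulC mulmxA.
have /(congr1 (fun M => \tr (M *m D))) := eqC.
by rewrite !mulmxDl !mxtraceD trC eqY trX addrC => /addrI.
Qed.

End DualNumbers.

(** * Commutators and traces with a Jordan block *)

Section Jordan.

Context {K : fieldType} {n : nat}.

(* The [k]-th power of the nilpotent Jordan block. *)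
Definition shift_mx (k : nat) : 'M[K]_n :=
  \matrix_(i, j) (j == (i + k)%N :> nat)%:R.

Lemma jordan_blockE alpha : jordan_block n alpha = alpha%:M + shift_mx 1.
Proof.
apply/matrixP=> i j; rewrite !mxE addn1 [i == j]eq_sym -val_eqE /=.
have [->|_] := @eqP nat j i; first by rewrite ltn_eqF // addr0.
by rewrite add0r; case: (_ == _).
Qed.

Lemma mul_mx_shift (A : 'M[K]_n) (i j j1 : 'I_n) :
  j = j1.+1 :> nat -> (A *m shift_mx 1) i j = A i j1.
Proof.
move=> ej; rewrite mxE (bigD1 j1) //= big1 => [|l ne_l].
  by rewrite mxE ej addn1 eqxx mulr1 addr0.
by rewrite mxE ej addn1 eqSS eq_sym val_eqE (negPf ne_l) mulr0.
Qed.

Lemma mul_shift_mx (A : 'M[K]_n) (i j i1 : 'I_n) :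
  i1 = i.+1 :> nat -> (shift_mx 1 *m A) i j = A i1 j.
Proof.
move=> ei; rewrite mxE (bigD1 i1) //= big1 => [|l ne_l].
  by rewrite mxE ei addn1 eqxx mul1r addr0.
by rewrite mxE addn1 -ei val_eqE (negPf ne_l) mul0r.
Qed.

Lemma mul_shift_mx_last (A : 'M[K]_n) (i j : 'I_n) :
  i.+1 = n -> (shift_mx 1 *m A) i j = 0.
Proof.
move=> ei; rewrite mxE big1 // => l _.
by rewrite mxE addn1 ei ltn_eqF // mul0r.
Qed.

Lemma shift_mx0 : shift_mx 0 = 1%:M.
Proof. by apply/matrixP=> i j; rewrite !mxE addn0 eq_sym. Qed.

Lemma shift_mxS k : shift_mx k.+1 = shift_mx 1 *m shift_mx k.
Proof.
apply/matrixP=> i j; have [lt_i1|le_n] := ltnP i.+1 n.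
  by rewrite (mul_shift_mx _ _ (i1 := Ordinal lt_i1)) // !mxE /= addSnnS.
have ei : i.+1 = n by apply/eqP; rewrite eqn_leq le_n ltn_ord.
rewrite mul_shift_mx_last // mxE addnS -addSn ei ltn_eqF //.
exact: leq_trans (ltn_ord j) (leq_addr _ _).
Qed.

(** [shift_mx k] is a polynomial in the Jordan block; this provides the hypothesis on [S] in
    [mxtrace_similar_dual]. *)
Lemma shift_mx_comm alpha (C : 'M[K]_n) k :
    C *m jordan_block n alpha = jordan_block n alpha *m C ->
  C *m shift_mx k = shift_mx k *m C.
Proof.
rewrite jordan_blockE mulmxDl mulmxDr scalar_mxC => /addrI cC.
elim: k => [|k IHk]; first by rewrite shift_mx0 mul1mx mulmx1.
by rewrite shift_mxS mulmxA cC -mulmxA IHk mulmxA.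
Qed.

(** With the factors swapped, only the diagonal entry in column 0 survives, and row 0 of
    [shift_mx k] picks out [beta k]. *)
Lemma mxtrace_first_col (beta : 'I_n -> K) (k : 'I_n) :
  \tr (first_col_mx beta *m shift_mx k) = beta k.
Proof.
have n_gt0 : (0 < n)%N by apply: leq_ltn_trans (ltn_ord k).
rewrite mxtrace_mulC /mxtrace (bigD1 (Ordinal n_gt0)) //= big1 => [|i ne_i].
  rewrite addr0 mxE (bigD1 k) //= big1 => [|l ne_l].
    by rewrite !mxE /= add0n eqxx mul1r addr0.
  by rewrite !mxE /= add0n val_eqE (negPf ne_l) mul0r.
rewrite mxE big1 // => l _; rewrite !mxE -val_eqE /= in ne_i *.
by rewrite (negPf ne_i) mulr0.
Qed.

(** Outside column 0, the equations on [P] link consecutive entries of a diagonal, so summing [A]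
    down that diagonal solves them. *)
Lemma first_col_mod_commutator alpha (A : 'M[K]_n) :
  exists P beta,
    A + (P *m jordan_block n alpha - jordan_block n alpha *m P)
      = first_col_mx beta.
Proof.
(* [A] is extended by zero, so that diagonal sums may run past the border. *)
pose a i j := if insub i is Some i' then
  if insub j is Some j' then A i' j' else 0 else 0 : K.
have aE (i j : 'I_n) : a i j = A i j by rewrite /a !valK.
have a0 i j : (n <= i)%N -> a i j = 0.
  by move=> le_ni; rewrite /a insubN -?leqNgt.
(* [p] solves [p i (j - 1) = p (i + 1) j - A i j], with [p = 0] out of range. *)
pose p i j := - \sum_(0 <= l < n) a (i + l)%N (j.+1 + l)%N.
pose P : 'M[K]_n := \matrix_(i, j) p i j.
pose B := A + (P *m shift_mx 1 - shift_mx 1 *m P).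
(* [beta] is column 0 of [B]. As [n] may be 0, index 0 goes through [insub]; the default is never
   reached, since a row index [i] forces [n] to be positive. *)
exists P, (fun i => if insub 0%N is Some j then B i j else 0).
rewrite jordan_blockE mulmxDl mulmxDr scalar_mxC opprD addrACA subrr add0r -/B.
apply/matrixP=> i j; rewrite [RHS]mxE.
have [j0|j_gt0] := posnP j; first by rewrite -j0 valK.
have lt_j1 : (j.-1 < n)%N by rewrite (leq_ltn_trans (leq_pred _)).
(* This includes the last row, where both sides are 0. *)
have PS : (shift_mx 1 *m P) i j = p i.+1 j.
  have [lt_i1|le_n] := ltnP i.+1 n.
    by rewrite (mul_shift_mx _ _ (i1 := Ordinal lt_i1)) // mxE.
  rewrite mul_shift_mx_last; last by apply/eqP; rewrite eqn_leq le_n ltn_ord.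
  by rewrite /p big1 ?oppr0 // => l _; rewrite a0 // (leq_trans le_n) ?leq_addr.
rewrite /B mxE mxE [X in _ + (_ + X)]mxE PS.
rewrite (mul_mx_shift _ _ (j1 := Ordinal lt_j1)) /= ?prednK //.
rewrite mxE /p /= prednK // opprK.
have -> : \sum_(0 <= l < n) a (i + l)%N (j + l)%N
        = A i j + \sum_(0 <= l < n) a (i.+1 + l)%N (j.+1 + l)%N.
  (* The added term [l = n] vanishes, row [i + n] being out of range; the term [l = 0] is then split
     off as [A i j]. *)
  have -> : \sum_(0 <= l < n) a (i + l)%N (j + l)%N
          = \sum_(0 <= l < n.+1) a (i + l)%N (j + l)%N.
    by rewrite big_nat_recr //= [a (i + n)%N _]a0 ?addr0 ?leq_addl.
  rewrite big_nat_recl // !addn0 aE; congr (_ + _).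
  by apply: eq_bigr => l _; rewrite !addSnnS.
by rewrite opprD addrA addrA subrr add0r addNr.
Qed.

End Jordan.

Theorem theorem4p1 (K : closedFieldType) (charK0 : [pchar K] =i pred0)
    (n : nat) (n_gt0 : (0 < n)%N) (A0 A1 : 'M[K]_n) (alpha : K)
    (hA0 : similar_mx A0 (jordan_block n alpha)) :
  exists! M : 'M[dual K]_n,
    similar_mx (dual_mx A0 A1) M /\
    exists beta : 'I_n -> K,
      M = dual_mx (jordan_block n alpha) (first_col_mx beta).
Proof.
have [B1 simB] := similar_dual_mx_const A1 hA0.
have [P [beta eqB]] := first_col_mod_commutator alpha B1.
have simM := similar_mx_trans simB (similar_dual_mx_commutator _ B1 P).
rewrite {}eqB in simM.
exists (dual_mx (jordan_block n alpha) (first_col_mx beta)).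
split=> [|M [simM' [beta' eqM]]]; first by split=> //; exists beta.
rewrite {M}eqM in simM' *; congr dual_mx.
(* Both normal forms are similar to the given matrix, hence to each other, and they share their
   constant part. *)
have sim := similar_mx_trans (similar_mx_sym simM) simM'.
apply/matrixP=> i j; rewrite !mxE -!mxtrace_first_col.
by rewrite (mxtrace_similar_dual (fun C => @shift_mx_comm _ _ alpha C i) sim).
Qed.
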